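(* Let $K\subset\mathbb R^n$ be a convex body and let $u\in S^{n-1}$. Then \[ S_u(K^c)\subseteq\mathrm{conv}_c(S_u(K^c))\subseteq(S_uK)^c. \] In particular $\mathrm{Vol}(K)\,\mathrm{Vol}(K^c)\le\mathrm{Vol}(S_uK)\,\mathrm{Vol}((S_uK)^c)$.
   Context: $B(x,r)$ is the closed Euclidean ball. For $A\subseteq\mathbb R^n$, $A^c=\bigcap_{x\in A}B(x,1)$ and $\mathrm{conv}_c(A)=A^{cc}$. For a convex body $L$ and $u\in S^{n-1}$, the Steiner symmetral $S_u(L)$ is defined as follows: for $x\in P_{u^\perp}L$ write $L\cap(x+\mathbb Ru)=[x+a(x)u,x+b(x)u]$; then $S_u(L)=\{x+tu:\ x\in P_{u^\perp}L,\ |t|\le\tfrac{b(x)-a(x)}2\}$ (with $S_u(\emptyset)=\emptyset$). *)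

(* Defs.v *)
From HB Require Import structures.
From mathcomp Require Import all_boot all_order all_algebra.
From mathcomp Require Import all_classical all_reals all_analysis.
Set Implicit Arguments. Unset Strict Implicit. Unset Printing Implicit Defensive.
Import Order.TTheory GRing.Theory Num.Theory.
Import numFieldTopology.Exports numFieldNormedType.Exports.
Local Open Scope classical_set_scope.
Local Open Scope ring_scope.

Section Defs.
Variables (R : realType) (n : nat).
Notation V := 'rV[R]_n.

Definition edot (x y : V) : R := \sum_(i < n) x 0 i * y 0 i.
Definition enorm (x : V) : R := Num.sqrt (edot x x).

Definition eball (x : V) (r : R) : set V := [set y | enorm (y - x) <= r].

Definition unit_sphere : set V := [set u | enorm u = 1].

Definition convex_set (A : set V) : Prop :=
  forall x y, A x -> A y -> forall t : R, 0 <= t -> t <= 1 ->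
    A (t *: x + (1 - t) *: y).

Definition convex_body (K : set V) : Prop :=
  [/\ convex_set K, compact K & (interior K) !=set0].

Definition cdual (A : set V) : set V := \bigcap_(x in A) eball x 1.

Definition conv_c (A : set V) : set V := cdual (cdual A).

(* Steiner symmetral S_u(L): for x in P_{u^perp} L, write
   L ∩ (x + R u) = [x + a u, x + b u]; then S_u L collects x + t u, |t| <= (b-a)/2. *)
Definition steiner (u : V) (L : set V) : set V :=
  [set y | exists x : V, exists a b : R, exists t : R,
     [/\ edot x u = 0, a <= b,
         [set s : R | L (x + s *: u)] = `[a, b]%classic,
         `|t| <= (b - a) / 2 & y = x + t *: u]].

(* Lebesgue (outer) measure on R^n, via countable covers by closed boxes *)
Definition box (lo hi : V) : set V := [set x | forall i, lo 0 i <= x 0 i <= hi 0 i].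
Definition boxvol (lo hi : V) : R := \prod_(i < n) (hi 0 i - lo 0 i).

Definition Vol (A : set V) : \bar R :=
  ereal_inf [set s | exists lo hi : nat -> V,
    [/\ (forall k i, lo k 0 i <= hi k 0 i),
        A `<=` \bigcup_k box (lo k) (hi k) &
        s = (\sum_(0 <= k <oo) (boxvol (lo k) (hi k))%:E)%E]].
End Defs.

(* Main.v *)
Require Import Defs.
From HB Require Import structures.
From mathcomp Require Import all_boot all_order all_algebra.
From mathcomp Require Import all_classical all_reals all_analysis.
From mathcomp Require Import measurable_realfun ring lra.
Import Order.TTheory GRing.Theory Num.Theory.
Import numFieldTopology.Exports numFieldNormedType.Exports.
Local Open Scope classical_set_scope.
Local Open Scope ring_scope.
Set Implicit Arguments. Unset Strict Implicit. Unset Printing Implicit Defensive.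

(* Inclusions: a point [x + t u] of [steiner u K] and a point [x' + s u] of
   [steiner u (cdual K)] come from chords [a, b] and [a', b'] all of whose
   endpoints are at distance at most 1 across the two sets, and [|t - s|] is at
   most the mean of [b - a'] and [b' - a]; hence the two points are at distance
   at most 1.

   Volume: it suffices that a closed bounded convex set [L] satisfies
   [Vol L <= Vol (steiner u L)].  If [u_i <> 0], parametrize R^(m+1) by
   [(r, t) |-> t + r u] with [t] in the hyperplane [x_i = 0]; this slanted map
   carries the product measure to a constant multiple of the volume of boxes
   (slice at fixed [r]).  Slicing at fixed [t] instead, every line parallel to
   [u] meets [L] and [steiner u L] in segments of the same length, which bounds
   the measure of [L] by that of any box cover of [steiner u L].  Conversely the
   measure of [L] dominates the outer volume [Vol L], because [L] is the
   decreasing intersection of the unions of the dyadic cells meeting it. *)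

(** * Boxes and the measures that scale their volume *)

(* [h = true] gives half-open boxes, which tile the space; [h = false] gives the
   closed boxes of [Vol]. *)
Definition hbox (R : realType) n (h : bool) (lo hi : 'rV[R]_n) : set 'rV[R]_n :=
  [set x | forall i, x 0 i \in Interval (BLeft (lo 0 i)) (BSide h (hi 0 i))].

Lemma hbox_falseE (R : realType) n (lo hi : 'rV[R]_n) :
  hbox false lo hi = box lo hi.
Proof. by apply/seteqP; split => x xb i; move: (xb i); rewrite in_itv. Qed.

Lemma boxvol_ge0 (R : realType) n (lo hi : 'rV[R]_n) :
  (forall i, lo 0 i <= hi 0 i) -> 0 <= boxvol lo hi.
Proof. by move=> le_lohi; apply: prodr_ge0 => i _; rewrite subr_ge0. Qed.

(** The pushforward of [nu] along [psi] is [c] times Lebesgue measure, required on boxes only, which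
    is all that [Vol] sees. Both kinds [h] occur: half-open boxes for tilings, closed ones for
    covers. *)
Definition scales_boxes (R : realType) d (X : measurableType d)
    (nu : set X -> \bar R) n (psi : X -> 'rV[R]_n) (c : R) :=
  [/\ 0 < c, forall j, measurable_fun setT (fun x => psi x 0 j) &
    forall h (lo hi : 'rV[R]_n), (forall i, lo 0 i <= hi 0 i) ->
      nu (psi @^-1` hbox h lo hi) = (c * boxvol lo hi)%:E].

Lemma measurable_preimage_hbox (R : realType) d (X : measurableType d) n
    (psi : X -> 'rV[R]_n) h lo hi :
  (forall j, measurable_fun setT (fun x => psi x 0 j)) ->
  measurable (psi @^-1` hbox h lo hi).
Proof.
move=> mpsi.
have -> : psi @^-1` hbox h lo hi = \bigcap_(j in [set: 'I_n])
    ((fun x => psi x 0 j) @^-1`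
      [set` Interval (BLeft (lo 0 j)) (BSide h (hi 0 j))]).
  by apply/seteqP; split => x xP j; [move=> _; exact: xP|exact: xP].
apply: fin_bigcap_measurable => // j _.
by rewrite -[X in measurable X]setTI; apply: mpsi => //; exact: measurable_itv.
Qed.

Lemma lebesgue_measure_bounded_itv (R : realType) (s s' : bool) (a b : R) :
  a <= b ->
  lebesgue_measure [set` Interval (BSide s a) (BSide s' b)] = (b - a)%:E.
Proof.
rewrite lebesgue_measure_itv /= lte_fin le_eqVlt => /predU1P[->|->].
  by rewrite ltxx subrr.
by rewrite EFinB.
Qed.

Lemma lebesgue_measure_preimage_scale (R : realType) (h : bool) (v a b : R) :
  v != 0 -> a <= b ->
  exists2 J : interval R,
    (forall r, (r * v \in Interval (BLeft a) (BSide h b)) = (r \in J)) &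
    lebesgue_measure [set` J] = ((b - a) / `|v|)%:E.
Proof.
rewrite neq_lt => /orP[v0|v0] le_ab.
  (* For negative [v] the endpoints swap, so the end that [h] may open becomes the left one. *)
  exists (Interval (BSide (~~ h) (b / v)) (BRight (a / v))).
    move=> r; rewrite !in_itv /= andbC ler_ndivlMr//.
    by case: h => /=; rewrite ?ler_ndivrMr ?ltr_ndivrMr.
  rewrite lebesgue_measure_bounded_itv ?ler_nM2r ?invr_lt0//.
  by rewrite ltr0_norm// invrN mulrN -mulNr opprB mulrBl.
exists (Interval (BLeft (a / v)) (BSide h (b / v))).
  move=> r; rewrite !in_itv /= ler_pdivrMr//.
  by case: h => /=; rewrite ?ler_pdivlMr ?ltr_pdivlMr.
rewrite lebesgue_measure_bounded_itv ?ler_pM2r ?invr_gt0//.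
by rewrite gtr0_norm// mulrBl.
Qed.

(** * Slanted parametrization of space *)

(** [unlift i j] is [None] only for [j = i], so the default 0 puts the image in the hyperplane
    [x_i = 0]. *)
Definition insert_coord (R : realType) m (i : 'I_m.+1) (w : 'rV[R]_m) :
    'rV[R]_m.+1 :=
  \row_j oapp (w 0) 0 (unlift i j).

Definition slant (R : realType) m (i : 'I_m.+1) (u : 'rV[R]_m.+1) T
    (phi : T -> 'rV[R]_m) (p : measurableTypeR R * T) : 'rV[R]_m.+1 :=
  insert_coord i (phi p.2) + p.1 *: u.

(** At fixed [r], coordinate [i] is [r * u 0 i] and the others are those of [phi t] translated by
    [r *: u]. The slice of a box is empty or the preimage of a translated box, of measure
    independent of [r]; the admissible [r] fill an interval of length
    [(hi 0 i - lo 0 i) / |u 0 i|]. *)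
Lemma scales_boxes_slant (R : realType) d (T : measurableType d)
    (mu : {sigma_finite_measure set T -> \bar R}) m (phi : T -> 'rV[R]_m)
    (c : R) (i : 'I_m.+1) (u : 'rV[R]_m.+1) :
  scales_boxes mu phi c -> u 0 i != 0 ->
  scales_boxes (@lebesgue_measure R \x mu)%E (slant i u phi) (c / `|u 0 i|).
Proof.
move=> [c0 mphi muphi] ui0.
have mslant j : measurable_fun setT (fun p => slant i u phi p 0 j).
  rewrite (_ : (fun p => _) =
    (fun p : measurableTypeR R * T => oapp (phi p.2 0) 0 (unlift i j) + p.1 * u 0 j)).
    apply: measurable_funD.
      case: (unlift i j) => [k|] /=; last exact: measurable_cst.
      exact: (measurableT_comp (mphi k) measurable_snd).
    by apply: measurable_funM => //; exact: measurable_fst.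
  by apply/funext => p; rewrite /slant !mxE.
split => // [|h lo hi le_lohi]; first by rewrite divr_gt0 ?normr_gt0.
have [J JE lamJ] :=
  @lebesgue_measure_preimage_scale R h (u 0 i) _ _ ui0 (le_lohi i).
rewrite /product_measure1 /=.
pose V : R := \prod_(j < m) (hi 0 (lift i j) - lo 0 (lift i j)).
rewrite (eq_integral (fun r : measurableTypeR R =>
    (c * V)%:E * (\1_[set` J] r)%:E)%E); last first.
  move=> r _ /=.
  have [rJ|rJ] := boolP (r \in J).
    rewrite indicE mem_set// mule1.
    pose sh (v : 'rV[R]_m.+1) : 'rV[R]_m := col' i (v - r *: u).
    rewrite (_ : xsection _ r = phi @^-1` hbox h (sh lo) (sh hi)).
      rewrite muphi => [|j]; last by rewrite !mxE lerD2r.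
      congr (_ * _)%:E; apply: eq_bigr => j _; rewrite !mxE; ring.
    apply/seteqP; split => [t /xsectionP rt j|t tb].
      move: (rt (lift i j)); rewrite /slant !mxE liftK/= !in_itv /= lerBlDr.
      by case: h {JE muphi rt} => /=; rewrite ?lerBrDr ?ltrBrDr.
    apply/xsectionP => j; rewrite /slant !mxE.
    case: (unliftP i j) => [k ->|->] /=; last by rewrite add0r JE.
    move: (tb k); rewrite !mxE !in_itv /= lerBlDr.
    by case: h {JE muphi tb} => /=; rewrite ?lerBrDr ?ltrBrDr.
  rewrite indicE memNset ?mule0//=; last by apply/negP.
  rewrite (_ : xsection _ r = set0) ?measure0//; apply/seteqP; split => // t.
  move=> /xsectionP /(_ i); rewrite /slant !mxE unlift_none /= add0r JE.
  by rewrite (negbTE rJ).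
rewrite ge0_integralZl_EFin//; last 2 first.
- by apply/measurable_EFinP/measurable_indic; exact: measurable_itv.
- by rewrite mulr_ge0 ?(ltW c0)//; apply: prodr_ge0 => j _; rewrite subr_ge0.
have -> : (\int[@lebesgue_measure R]_r (\1_[set` J] r)%:E)%E =
    lebesgue_measure [set` J].
  rewrite -[in RHS](setIT [set` J]); exact: integral_indic.
rewrite lamJ -EFinM; congr (_ %:E); rewrite /boxvol (bigD1_ord i) //= -/V; ring.
Qed.

(** Nondecreasing exhaustions are taken so that two covering indices can be replaced by their
    maximum. *)
Lemma sigma_finite_product_measure (R : realType) d1 d2
    (T1 : measurableType d1) (T2 : measurableType d2)
    (m1 : {sigma_finite_measure set T1 -> \bar R})
    (m2 : {sigma_finite_measure set T2 -> \bar R}) :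
  sigma_finite setT (m1 \x m2)%E.
Proof.
have /sigma_finiteP[F [TF ndF Foo]] := sigma_finiteT m1.
have /sigma_finiteP[G [TG ndG Goo]] := sigma_finiteT m2.
exists (fun k => F k `*` G k) => [|k].
  apply/seteqP; split => // -[x y] _.
  have [k _ Fkx] : (\bigcup_k F k) x by rewrite -TF.
  have [l _ Gly] : (\bigcup_k G k) y by rewrite -TG.
  exists (maxn k l) => //; split => /=.
    by move: Fkx; apply/subsetPset/ndF/leq_maxl.
  by move: Gly; apply/subsetPset/ndG/leq_maxr.
have [mF finF] := Foo k; have [mG finG] := Goo k.
split; first exact: measurableX.
by rewrite product_measure1E// lte_mul_pinfty// ge0_fin_numE.
Qed.

(** Induction on the dimension from a Dirac mass on a point, the empty product of side lengths being
    1. Slanting along the first basis vector keeps the constant 1. *)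
Lemma scales_boxes_exists (R : realType) m :
  exists d (T : measurableType d) (mu : {sigma_finite_measure set T -> \bar R})
    (phi : T -> 'rV[R]_m), scales_boxes mu phi 1.
Proof.
elim: m => [|m [d [T [mu [phi muphi]]]]].
  exists _, unit, (dirac tt : {sigma_finite_measure set unit -> \bar R}).
  exists (fun=> 0).
  split => // h lo hi _.
  rewrite (_ : _ @^-1` _ = setT); last by apply/seteqP; split => // x _ [].
  by rewrite /boxvol big_ord0 mulr1 /= diracE mem_set.
pose e0 : 'rV[R]_m.+1 := delta_mx 0 ord0.
have e00 : e0 0 ord0 = 1 by rewrite mxE !eqxx.
have := scales_boxes_slant muphi (i := ord0) (u := e0).
rewrite e00 normr1 divr1 oner_eq0 => /(_ isT).
set nu := (_ \x _)%E => nuP.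
pose sf := Measure_isSigmaFinite.Build _ _ _ nu
  (sigma_finite_product_measure (@lebesgue_measure R) mu).
pose nu' : {sigma_finite_measure set _ -> \bar R} := HB.pack nu sf.
by exists _, (measurableTypeR R * T)%type, nu', (slant ord0 e0 phi).
Qed.

(** * Dyadic approximation from outside *)

Lemma floor_eq_dist (R : realType) (a b : R) :
  Num.floor a = Num.floor b -> `|a - b| < 1.
Proof.
move=> ab; have := floor_itv a; have := floor_itv b.
rewrite ab intrD => /andP[? ?] /andP[? ?].
by rewrite ltr_norml; apply/andP; split; lra.
Qed.

(** The floor of [t] is the integer half of the floor of [2 * t]; hence cells of level [k + 1]
    refine those of level [k]. *)
Lemma floor_double (R : realType) (a b : R) :
  Num.floor (2 * a) = Num.floor (2 * b) -> Num.floor a = Num.floor b.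
Proof.
have double (t : R) : Num.floor t = (Num.floor (2 * t) %/ 2)%Z.
  apply: floor_def.
  have := floor_itv (2 * t); have := divz_eq (Num.floor (2 * t)) 2.
  have := modz_ge0 (Num.floor (2 * t)) (isT : 2 != 0 :> int).
  have := ltz_pmod (Num.floor (2 * t)) (isT : 0 < 2 :> int).
  set q := (_ %/ _)%Z; set r := (_ %% _)%Z => r2 r0 ->.
  have : (0 : R) <= r%:~R by rewrite ler0z.
  have : (r%:~R : R) <= 1 by rewrite -[leRHS]/(1%:~R) ler_int -ltzD1.
  rewrite !intrD intrM => ? ? /andP[? ?]; apply/andP; split; lra.
by move=> ab; rewrite double ab -double.
Qed.

Definition dyadic_cell (R : realType) n k (x : 'rV[R]_n) : 'rV[int]_n :=
  \row_j Num.floor (2 ^+ k * x 0 j).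

Definition dyadic_hull (R : realType) n k (L : set 'rV[R]_n) : set 'rV[R]_n :=
  [set x | exists2 y, L y & dyadic_cell k y = dyadic_cell k x].

Lemma dyadic_cell_dist (R : realType) n k (x y : 'rV[R]_n) j :
  dyadic_cell k x = dyadic_cell k y -> `|x 0 j - y 0 j| < (2 ^+ k)^-1.
Proof.
move=> /rowP/(_ j); rewrite !mxE => /floor_eq_dist.
have p0 : 0 < (2 : R) ^+ k by rewrite exprn_gt0.
by rewrite -mulrBr normrM (gtr0_norm p0) -ltr_pdivlMl// mulr1.
Qed.

Lemma dyadic_hull_homo (R : realType) n (L : set 'rV[R]_n) :
  {homo (fun k => dyadic_hull k L) : k l / (k <= l)%N >-> l `<=` k}.
Proof.
apply: homo_leq => [A x //|B A C BA CB x /CB /BA //|k x [y Ly yx]].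
exists y => //; apply/rowP => j; move/rowP: yx => /(_ j).
by rewrite !mxE !exprS -!mulrA => /floor_double.
Qed.

(** A point of every hull has, for each [k], a point of [L] within [2^-k] in each coordinate, so it
    lies in the closure of [L]. *)
Lemma bigcap_dyadic_hull (R : realType) n (L : set 'rV[R]_n) :
  closed L -> \bigcap_k dyadic_hull k L = L.
Proof.
move=> cL; apply/seteqP; split => [x xL|x Lx k _]; last by exists x.
apply: cL => B /nbhs_ballP[e /= e0 xeB].
set k := Num.Def.archi_bound e^-1.
have [y Ly yx] := xL k I; exists y; split => //; apply: xeB; split => // i j.
rewrite ord1 /ball /= distrC (lt_trans (dyadic_cell_dist j yx))//.
by rewrite -(invrK e) ltf_pV2 ?posrE ?invr_gt0 ?exprn_gt0// upper_nthrootP.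
Qed.

(** Cells are indexed by integer vectors, which are countable. Positive dimension makes degenerate
    half-open boxes empty; in dimension 0 every box is the whole space. *)
Lemma dyadic_hull_partition (R : realType) n k (L : set 'rV[R]_n.+1) :
  exists lo hi : nat -> 'rV[R]_n.+1,
    [/\ forall i j, lo i 0 j <= hi i 0 j,
        trivIset setT (fun i => hbox true (lo i) (hi i)) &
        dyadic_hull k L = \bigcup_i hbox true (lo i) (hi i)].
Proof.
(* [pickle_inv] yields [Some z] only at the index [pickle z], so each cell is listed once and the
   boxes are disjoint. *)
pose decode (i : nat) : option 'rV[int]_n.+1 := pickle_inv i.
pose meets (z : 'rV[int]_n.+1) := `[<exists2 y, L y & dyadic_cell k y = z>].
(* degenerate, hence empty, for indices that encode no cell meeting [L] *)
pose corner e i : 'rV[R]_n.+1 :=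
  if decode i is Some z then
    if meets z then \row_j ((z 0 j + e)%:~R / 2 ^+ k) else 0
  else 0.
have p0 : 0 < (2 : R) ^+ k by rewrite exprn_gt0.
have cellP i x : hbox true (corner 0 i) (corner 1 i) x <->
    decode i = Some (dyadic_cell k x) /\ meets (dyadic_cell k x).
  split.
    move=> xi; have := xi ord0; move: xi; rewrite /corner.
    have empty (r : R) : ~ (r \in Interval (BLeft 0) (BSide true 0)).
      by rewrite in_itv /= => /andP[/le_lt_trans/[apply]]; rewrite ltxx.
    case: (decode i) => [z|]; last by rewrite mxE => _ /empty.
    case: ifPn => [mz xz _|_]; last by rewrite mxE => _ /empty.
    have -> : dyadic_cell k x = z.
      apply/rowP => j; rewrite mxE; apply: floor_def.
      move: (xz j); rewrite !mxE in_itv /= addr0 ler_pdivrMr// ltr_pdivlMr//.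
      by rewrite mulrC.
    by split.
  move=> [xi mx] j; rewrite /corner xi mx !mxE in_itv /= addr0.
  rewrite ler_pdivrMr// ltr_pdivlMr// mulrC.
  exact: floor_itv.
exists (corner 0), (corner 1); split.
- move=> i j; rewrite /corner; case: (decode i) => // z; case: ifP => // _.
  by rewrite !mxE ler_pM2r ?invr_gt0// ler_int lerD2l.
- move=> i i' _ _ [x [/cellP[xi _] /cellP[xi' _]]].
  have decodeK l : oapp pickle l (decode l) = l by exact: pickle_invK.
  by rewrite -(decodeK i) -(decodeK i') xi xi'.
- apply/seteqP; split => [x [y Ly yx]|x [i _ /cellP[_ /asboolP]]//].
  exists (pickle (dyadic_cell k x)) => //; apply/cellP; rewrite /decode pickleK_inv.
  by split => //; apply/asboolP; exists y.
Qed.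

(** * Outer volume against measure *)

(** Each hull has measure [c] times the total volume of its cells, whose closures cover [L], so it
    dominates [c * Vol L]. Continuity from above passes this to [L]. *)
Lemma scaled_Vol_le_measure (R : realType) d (X : measurableType d)
    (nu : {measure set X -> \bar R}) n (psi : X -> 'rV[R]_n.+1) (c M : R)
    (L : set 'rV[R]_n.+1) :
  scales_boxes nu psi c -> closed L ->
  (forall x, L x -> forall i, `|x 0 i| <= M) ->
  measurable (psi @^-1` L) /\ (c%:E * Vol L <= nu (psi @^-1` L))%E.
Proof.
move=> [c0 mpsi nuE] cL LM.
have mhull k : measurable (psi @^-1` dyadic_hull k L).
  have [lo [hi [_ _ ->]]] := dyadic_hull_partition k L.
  rewrite preimage_bigcup; apply: bigcup_measurable => i _.
  exact: measurable_preimage_hbox.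
have hullE : psi @^-1` L = \bigcap_k (psi @^-1` dyadic_hull k L).
  by rewrite -preimage_bigcap bigcap_dyadic_hull.
split; first by rewrite hullE; exact: bigcapT_measurable.
have Vol_hull k : (c%:E * Vol L <= nu (psi @^-1` dyadic_hull k L))%E.
  have [lo [hi [le_lohi tlohi LE]]] := dyadic_hull_partition k L.
  have -> : (nu (psi @^-1` dyadic_hull k L) =
      c%:E * \sum_(0 <= i <oo) (boxvol (lo i) (hi i))%:E)%E.
    rewrite LE preimage_bigcup measure_semi_bigcup; last 3 first.
    - by move=> i; exact: measurable_preimage_hbox.
    - by move=> i i' _ _ [p [pi pi']]; apply: tlohi => //; exists (psi p).
    - by apply: bigcup_measurable => i _; exact: measurable_preimage_hbox.
    rewrite -nneseriesZl; last by move=> i _; rewrite lee_fin boxvol_ge0.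
    by apply: eq_eseriesr => i _; rewrite nuE.
  rewrite lee_pmul2l ?lte_fin//; apply: ereal_inf_lbound; exists lo, hi.
  split => // x Lx.
  have : dyadic_hull k L x by exists x.
  rewrite LE => -[i _ xi]; exists i => // j.
  by move: (xi j); rewrite in_itv /= => /andP[-> /ltW].
have ->: nu (psi @^-1` L) = nu (\bigcap_k (psi @^-1` dyadic_hull k L)).
  by rewrite hullE.
apply: (@cvge_ge _ \oo _ _ (nu \o (fun k => psi @^-1` dyadic_hull k L))).
  by apply: nearW => k /=; exact: Vol_hull.
apply: nonincreasing_cvg_mu => //; last 2 first.
- exact: bigcapT_measurable.
- by move=> k l kl; apply/subsetPset => p /(dyadic_hull_homo kl).
(* Continuity from above needs the hull of level 0 to have finite measure. Its cells have side 1,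
   hence the margin 1; the absolute value covers a negative [M], possible when [L] is empty. *)
pose b : 'rV[R]_n.+1 := const_mx (`|M| + 1).
apply: (@le_lt_trans _ _ (nu (psi @^-1` hbox false (- b) b))).
  apply: le_measure; rewrite ?inE//; first exact: measurable_preimage_hbox.
  move=> p [y Ly /dyadic_cell_dist yp] j.
  have := yp j; have := LM _ Ly j; have := ler_norm M.
  rewrite !mxE in_itv /= expr0 invr1 -ler_norml => ? ? ?.
  have : `|psi p 0 j| <= `|y 0 j| + `|y 0 j - psi p 0 j|.
    by rewrite -[X in `|X| <= _](subKr (y 0 j)) (le_trans (ler_normB _ _)).
  lra.
rewrite nuE ?ltry// => j; rewrite !mxE.
by rewrite (@le_trans _ _ 0) ?oppr_le0 ?addr_ge0.
Qed.

(** * Chords of a closed bounded convex set *)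

(** The set of parameters is closed, and bounded because coordinate [i] moves at the nonzero rate
    [u 0 i]; its supremum is therefore attained. *)
Lemma fiber_max (R : realType) n (L : set 'rV[R]_n) (M : R) (q u : 'rV[R]_n) i :
  closed L -> (forall x, L x -> forall j, `|x 0 j| <= M) -> u 0 i != 0 ->
  (exists s, L (q + s *: u)) ->
  exists2 b, L (q + b *: u) & forall s, L (q + s *: u) -> s <= b.
Proof.
move=> cL LM ui0 [s0 Ls0]; pose F := [set s : R | L (q + s *: u)].
have cF : closed F.
  apply: (closed_comp (f := fun s : R => q + s *: u)) cL => s _.
  by apply: cvgD; [exact: cvg_cst|apply: cvgZr_tmp; exact: cvg_id].
have ubF : has_ubound F.
  exists ((M + `|q 0 i|) / `|u 0 i|) => s Fs.
  rewrite ler_pdivlMr ?normr_gt0//.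
  rewrite (le_trans (ler_wpM2r (normr_ge0 _) (ler_norm s)))// -normrM.
  have := LM _ Fs i; rewrite !mxE => qsM.
  rewrite -[s * _](addKr (q 0 i)) addrC (le_trans (ler_normB _ _))//.
  by rewrite lerD2r.
have F0 : F !=set0 by exists s0.
exists (sup F) => [|s Fs]; last exact: ub_le_sup.
by apply: cF; exact: closure_sup.
Qed.

Lemma fiber_itv (R : realType) n (L : set 'rV[R]_n) (M : R) (q u : 'rV[R]_n) i :
  closed L -> Defs.convex_set L -> (forall x, L x -> forall j, `|x 0 j| <= M) ->
  u 0 i != 0 -> (exists s, L (q + s *: u)) ->
  exists a b, a <= b /\ [set s | L (q + s *: u)] = `[a, b]%classic.
Proof.
move=> cL convL LM ui0 Lq; have [b Lb bmax] := fiber_max cL LM ui0 Lq.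
have [a La amin] : exists2 a, L (q + a *: u) &
    forall s, L (q + s *: u) -> a <= s.
  (* The least parameter is minus the greatest one for direction [- u]. *)
  have [||a La amax] := @fiber_max _ _ L M q (- u) i cL LM.
  - by rewrite mxE oppr_eq0.
  - by have [s Ls] := Lq; exists (- s); rewrite scalerN scaleNr opprK.
  exists (- a) => [|s Ls]; first by rewrite scaleNr -scalerN.
  by rewrite lerNl amax// scalerN scaleNr opprK.
have le_ab : a <= b by exact: amin.
exists a, b; split => //.
apply/seteqP; split => s /=; rewrite in_itv /=.
  by move=> Ls; rewrite amin ?bmax.
(* A one-point chord is set apart, since the convex weights divide by [b - a]. *)
have [ab|lt_ab] := ltP a b; last first.
  by rewrite (@le_anti _ _ a b) ?le_ab// -eq_le => /eqP <-.
move=> /andP[as_ sb]; have ab0 : 0 < b - a by rewrite subr_gt0.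
have t0 : 0 <= (b - s) / (b - a) by apply: divr_ge0; [rewrite subr_ge0|exact: ltW].
have t1 : (b - s) / (b - a) <= 1 by rewrite ler_pdivrMr// mul1r lerD2l lerN2.
suff -> : q + s *: u = (b - s) / (b - a) *: (q + a *: u) +
    (1 - (b - s) / (b - a)) *: (q + b *: u) by exact: (convL _ _ La Lb _ t0 t1).
apply/rowP => j; rewrite !mxE.
by field; rewrite subr_eq0 gt_eqF.
Qed.

(** * Euclidean inner product *)

Lemma edotC (R : realType) n (x y : 'rV[R]_n) : edot x y = edot y x.
Proof. by apply: eq_bigr => i _; rewrite mulrC. Qed.

Lemma edotDl (R : realType) n (x y z : 'rV[R]_n) :
  edot (x + y) z = edot x z + edot y z.
Proof. by rewrite -big_split; apply: eq_bigr => i _; rewrite mxE mulrDl. Qed.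

Lemma edotZl (R : realType) n k (x z : 'rV[R]_n) : edot (k *: x) z = k * edot x z.
Proof. by rewrite /edot mulr_sumr; apply: eq_bigr => i _; rewrite mxE mulrA. Qed.

Lemma edot_ge0 (R : realType) n (x : 'rV[R]_n) : 0 <= edot x x.
Proof. by apply: sumr_ge0 => i _; rewrite -expr2 sqr_ge0. Qed.

Lemma edot_unit (R : realType) n (u : 'rV[R]_n) : unit_sphere u -> edot u u = 1.
Proof. by move=> u1; rewrite -(sqr_sqrtr (edot_ge0 u)) -/(enorm u) u1 expr1n. Qed.

Lemma eball1E (R : realType) n (x y : 'rV[R]_n) :
  eball x 1 y <-> edot (y - x) (y - x) <= 1.
Proof. by rewrite /eball /= /enorm -{1}(sqrtr1 R) ler_sqrt. Qed.

Lemma unit_sphere_coord (R : realType) n (u : 'rV[R]_n) :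
  unit_sphere u -> exists i, u 0 i != 0.
Proof.
move=> /edot_unit u1; apply/existsP; rewrite -negb_forall; apply/negP => /forallP u0.
have : edot u u = 0 by apply: big1 => i _; rewrite (eqP (u0 i)) mul0r.
by rewrite u1 => /eqP; rewrite oner_eq0.
Qed.

(** * Steiner symmetrization does not decrease volume *)

(** Slicing in the other order gives the same measure, by uniqueness on rectangles. *)
Lemma product_measure_ysection (R : realType) d1 d2 (T1 : measurableType d1)
    (T2 : measurableType d2) (m1 : {sigma_finite_measure set T1 -> \bar R})
    (m2 : {sigma_finite_measure set T2 -> \bar R}) (X : set (T1 * T2)) :
  measurable X -> ((m1 \x m2) X = \int[m2]_y m1 (ysection X y))%E.
Proof.
move=> mX.
have := @product_measure_unique _ _ _ _ _ m1 m2 (m1 \x^ m2)%E; apply => //.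
by move=> A B mA mB; exact: product_measure2E.
Qed.

Lemma measure_le_scaled_Vol_steiner (R : realType) d (T : measurableType d)
    (mu : {sigma_finite_measure set T -> \bar R}) m (phi : T -> 'rV[R]_m)
    (c M : R) (i : 'I_m.+1) (u : 'rV[R]_m.+1) (L : set 'rV[R]_m.+1) :
  scales_boxes mu phi c -> u 0 i != 0 -> unit_sphere u ->
  closed L -> Defs.convex_set L -> (forall x, L x -> forall j, `|x 0 j| <= M) ->
  ((@lebesgue_measure R \x mu) (slant i u phi @^-1` L) <=
    (c / `|u 0 i|)%:E * Vol (steiner u L))%E.
Proof.
move=> muphi ui0 u1 cL convL LM.
have nuP := scales_boxes_slant muphi ui0.
have [mL _] := scaled_Vol_le_measure nuP cL LM.
have [c0 mslant nuE] := nuP.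
rewrite -lee_pdivrMl//; apply: le_ereal_inf_tmp => _ [lo [hi [le_lohi SL ->]]].
rewrite lee_pdivrMl// -nneseriesZl; last first.
  by move=> k _; rewrite lee_fin boxvol_ge0.
pose B k := slant i u phi @^-1` hbox false (lo k) (hi k).
have mB k : measurable (B k) by exact: measurable_preimage_hbox.
have mUB : measurable (\bigcup_k B k) by exact: bigcup_measurable.
rewrite (eq_eseriesr (g := fun k =>
    (@lebesgue_measure R \x mu)%E (B k))); last first.
  by move=> k _; rewrite nuE.
(* Countable subadditivity bounds the union by the sum; it remains to compare slices at fixed
   [t]. *)
apply: (@le_trans _ _ ((@lebesgue_measure R \x mu)%E (\bigcup_k B k)));
  last first.
  exact: (measure_sigma_subadditive _ mB mUB (fun _ => id)).
rewrite !product_measure_ysection//; apply: ge0_le_integral => //.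
- exact: measurable_fun_ysection.
- exact: measurable_fun_ysection.
move=> t _; set p := insert_coord i (phi t).
(* [steiner] wants base points orthogonal to [u], so [p] is projected to [q]; this shifts the
   parameter of the line by [dl]. *)
pose dl := edot p u; pose q := p - dl *: u.
have qu : edot q u = 0 by rewrite edotDl -scaleNr edotZl edot_unit// mulr1 /dl subrr.
have slantE r : slant i u phi (r, t) = q + (r + dl) *: u.
  by rewrite /slant /= -/p scalerDl addrACA addNr addr0.
have [Lq|Lq] := pselect (exists s, L (q + s *: u)); last first.
  rewrite (_ : ysection _ t = set0) ?measure0//; apply/seteqP; split => // r.
  by move=> /ysectionP; rewrite /= slantE => Lr; apply: Lq; exists (r + dl).
have [a [b [le_ab Lab]]] := fiber_itv cL convL LM ui0 Lq.
rewrite (_ : ysection _ t = `[a - dl, b - dl]%classic); last first.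
  apply/seteqP; split => [r /ysectionP|r rab]; last apply/ysectionP.
    rewrite /= slantE => Lr.
    have : [set s | L (q + s *: u)] (r + dl) by [].
    by rewrite Lab /= !in_itv /= lerBlDr lerBrDr.
  rewrite /preimage /= slantE.
  suff : [set s | L (q + s *: u)] (r + dl) by [].
  by move: rab; rewrite Lab /= !in_itv /= lerBlDr lerBrDr.
(* The centred chord of the symmetral on the same line, in the parameter [r]. *)
pose J : set R := `[- ((b - a) / 2) - dl, (b - a) / 2 - dl]%classic.
have lenE : lebesgue_measure `[a - dl, b - dl]%classic = lebesgue_measure J.
  by rewrite !lebesgue_measure_bounded_itv; [congr _%:E; field|lra|lra].
rewrite [leLHS](_ : _ = lebesgue_measure J); last exact: lenE.
apply: (@le_measure _ _ _ (@lebesgue_measure R)); rewrite ?inE; first exact: measurable_itv.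
  exact: measurable_ysection.
move=> r; rewrite /J /= in_itv /= => /andP[r1 r2]; apply/ysectionP.
have : steiner u L (q + (r + dl) *: u).
  exists q, a, b, (r + dl); split => //.
  by rewrite ler_norml; apply/andP; split; lra.
move=> /SL[k _ rk]; exists k => //.
by rewrite /B /= slantE hbox_falseE.
Qed.

Lemma Vol_le_steiner (R : realType) n (L : set 'rV[R]_n) (M : R) (u : 'rV[R]_n) :
  unit_sphere u -> closed L -> Defs.convex_set L ->
  (forall x, L x -> forall j, `|x 0 j| <= M) ->
  (Vol L <= Vol (steiner u L))%E.
Proof.
case: n L u => [|m] L u u1 cL convL LM.
  (* Dimension 0 has no unit vector. *)
  by have [[]] := unit_sphere_coord u1.
have [i ui0] := unit_sphere_coord u1.
have [d [T [mu [phi muphi]]]] := scales_boxes_exists R m.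
have nuP := scales_boxes_slant muphi ui0.
have [_ upper] := scaled_Vol_le_measure nuP cL LM.
have lower := measure_le_scaled_Vol_steiner muphi ui0 u1 cL convL LM.
have [c0 _ _] := nuP.
by have := le_trans upper lower; rewrite lee_pmul2l ?lte_fin.
Qed.

Lemma Vol_ge0 (R : realType) n (A : set 'rV[R]_n) : (0 <= Vol A)%E.
Proof.
apply: le_ereal_inf_tmp => _ [lo [hi [le_lohi _ ->]]].
by apply: nneseries_ge0 => k _ _; rewrite lee_fin boxvol_ge0.
Qed.

Lemma le_Vol (R : realType) n (A B : set 'rV[R]_n) :
  A `<=` B -> (Vol A <= Vol B)%E.
Proof.
move=> AB; apply: ereal_inf_le_tmp => s [lo [hi [le_lohi Bcov sE]]].
by exists lo, hi; split => // x /AB /Bcov.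
Qed.

(** * Properties of the ball dual *)

Lemma cdualS (R : realType) n (A B : set 'rV[R]_n) :
  A `<=` B -> cdual B `<=` cdual A.
Proof. by move=> AB y By x /AB; exact: By. Qed.

(** Both inclusions say that all distances between [A] and [B] are at most 1. *)
Lemma cdual_sym (R : realType) n (A B : set 'rV[R]_n) :
  A `<=` cdual B -> B `<=` cdual A.
Proof.
move=> AB y By x Ax; have := AB x Ax y By.
rewrite !eball1E -(opprB y x) -scaleN1r edotZl edotC edotZl mulrA.
by rewrite mulrNN !mul1r.
Qed.

Lemma closed_cdual (R : realType) n (A : set 'rV[R]_n) : closed (cdual A).
Proof.
apply: closed_bigI => x _.
rewrite (_ : eball x 1 =
    (fun y => edot (y - x) (y - x)) @^-1` [set r | r <= 1]); last first.
  by apply/seteqP; split => y /eball1E.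
apply: closed_comp; last exact: closed_le.
pose f s (z : 'rV[R]_n) := \sum_(i <- s) (z - x) 0 i * (z - x) 0 i.
suff cf s : continuous (f s) by move=> y _; exact: cf.
move=> y; elim: s => [|i s IHs].
  rewrite (_ : f [::] = cst 0); first exact: cst_continuous.
  by apply/funext => z; rewrite /f big_nil.
rewrite (_ : f (i :: s) =
    (fun z => (z 0 i - x 0 i) * (z 0 i - x 0 i) + f s z)); last first.
  by apply/funext => z; rewrite /f big_cons !mxE.
have czi : (fun z : 'rV[R]_n => z 0 i - x 0 i) @ y --> y 0 i - x 0 i.
  have ci : (fun z : 'rV[R]_n => z 0 i) @ y --> y 0 i by exact: coord_continuous.
  exact: cvgB ci (cvg_cst (x 0 i)).
exact: cvgD (cvgM czi czi) IHs.
Qed.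

Lemma convex_cdual (R : realType) n (A : set 'rV[R]_n) :
  Defs.convex_set (cdual A).
Proof.
move=> y z yA zA t t0 t1 x Ax; apply/eball1E.
have /eball1E y1 := yA x Ax; have /eball1E z1 := zA x Ax.
apply: (@le_trans _ _ (t * edot (y - x) (y - x) + (1 - t) * edot (z - x) (z - x))).
  rewrite /edot !mulr_sumr -big_split; apply: ler_sum => i _; rewrite !mxE /=.
  (* The convexity defect of the square is [t (1 - t) (y_i - z_i)^2]. *)
  rewrite -subr_ge0 [leRHS](_ : _ = t * (1 - t) * (y 0 i - z 0 i) ^+ 2); last ring.
  by rewrite mulr_ge0 ?sqr_ge0// mulr_ge0// subr_ge0.
have ? : t * edot (y - x) (y - x) <= t by rewrite ler_piMr.
have : (1 - t) * edot (z - x) (z - x) <= 1 - t by rewrite ler_piMr ?subr_ge0.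
lra.
Qed.

Lemma compact_coord_bounded (R : realType) n (K : set 'rV[R]_n) :
  compact K -> exists M, forall x, K x -> forall j, `|x 0 j| <= M.
Proof.
move=> /compact_bounded[M [_ KM]]; exists (M + 1) => x Kx j.
apply: le_trans (KM (M + 1) _ x Kx); last by rewrite ltrDl.
by rewrite [leRHS]mx_normrE; exact: (le_bigmax 0 (fun ij => `|x ij.1 ij.2|) (0, j)).
Qed.

(** The dual lies in the unit ball about any point of [A]; for empty [A] it is the whole space. *)
Lemma cdual_coord_bounded (R : realType) n (A : set 'rV[R]_n) :
  A !=set0 -> exists M, forall y, cdual A y -> forall j, `|y 0 j| <= M.
Proof.
move=> [x Ax]; exists (enorm x + 1) => y /(_ x Ax) yx j.
have coord_le (v : 'rV[R]_n) : `|v 0 j| <= enorm v.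
  rewrite -sqrtr_sqr ler_wsqrtr// /edot (bigD1 j)//= expr2 lerDl.
  by apply: sumr_ge0 => i _; rewrite -expr2 sqr_ge0.
rewrite -(subrK (x 0 j) (y 0 j)) (le_trans (ler_normD _ _))// addrC.
by rewrite lerD// (le_trans _ yx)// (le_trans _ (coord_le _))// !mxE.
Qed.

Lemma edot_add_orthogonal (R : realType) n (w u : 'rV[R]_n) r :
  edot w u = 0 -> edot u u = 1 ->
  edot (w + r *: u) (w + r *: u) = edot w w + r ^+ 2.
Proof.
move=> wu uu.
rewrite edotDl edotZl ![edot _ (w + _)]edotC !edotDl !edotZl.
by rewrite wu (edotC u w) wu uu; ring.
Qed.

(** * The inclusions and the volume inequality *)

Lemma steiner_cdual_sub (R : realType) n (K : set 'rV[R]_n) (u : 'rV[R]_n) :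
  unit_sphere u -> steiner u K `<=` cdual (steiner u (cdual K)).
Proof.
move=> u1 _ [x [a [b [t [xu le_ab Kab tab ->]]]]].
move=> _ [x' [a' [b' [s [xu' le_ab' Kab' sab ->]]]]].
have uu := edot_unit u1; pose w := x - x'.
have wu : edot w u = 0 by rewrite edotDl -scaleN1r edotZl xu xu' mulr0 addr0.
have normE r := edot_add_orthogonal r wu uu.
have distE p q : x + p *: u - (x' + q *: u) = w + (p - q) *: u.
  by rewrite opprD addrACA -scalerBl.
have dist_ends p q : `[a, b]%classic p -> `[a', b']%classic q ->
    edot w w + (p - q) ^+ 2 <= 1.
  rewrite -Kab -Kab' /= => Kp /(_ _ Kp)/eball1E.
  rewrite -normE -distE -opprB -scaleN1r edotZl edotC edotZl mulrA.
  by rewrite mulrNN !mul1r.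
apply/eball1E; rewrite distE normE.
(* Only the two crossed pairs of chord ends are needed. *)
have d1 : edot w w + (b - a') ^+ 2 <= 1.
  by apply: dist_ends; rewrite /= in_itv /= lexx ?le_ab ?le_ab'.
have d2 : edot w w + (a - b') ^+ 2 <= 1.
  by apply: dist_ends; rewrite /= in_itv /= lexx ?le_ab ?le_ab'.
move: tab sab; rewrite !ler_norml => /andP[? ?] /andP[? ?].
(* [|t - s|] is at most the mean of [b - a'] and [b' - a] *)
have : (t - s) ^+ 2 <= (((b - a') + (b' - a)) / 2) ^+ 2.
  rewrite -subr_ge0 subr_sqr mulr_ge0//; lra.
(* Convexity of the square, which turns the two end estimates into one for their mean. *)
have : (((b - a') + (b' - a)) / 2) ^+ 2 <= ((b - a') ^+ 2 + (a - b') ^+ 2) / 2.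
  have := sqr_ge0 ((b - a') - (b' - a)); nra.
lra.
Qed.

Theorem theorem5p8 (R : realType) (n : nat) (K : set 'rV[R]_n) (u : 'rV[R]_n) :
  convex_body K -> unit_sphere u ->
  (steiner u (cdual K) `<=` conv_c (steiner u (cdual K)) /\
   conv_c (steiner u (cdual K)) `<=` cdual (steiner u K)) /\
  (Vol K * Vol (cdual K) <= Vol (steiner u K) * Vol (cdual (steiner u K)))%E.
Proof.
move=> [convK compK intK] u1.
have sub1 : steiner u (cdual K) `<=` conv_c (steiner u (cdual K)).
  exact: cdual_sym.
have sub2 : conv_c (steiner u (cdual K)) `<=` cdual (steiner u K).
  exact/cdualS/steiner_cdual_sub.
split => //.
have K0 : K !=set0 by have [x /interior_subset Kx] := intK; exists x.
have [M KM] := compact_coord_bounded compK.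
have [M' KM'] := cdual_coord_bounded K0.
(* The inequality holds factor by factor; the second factor passes through the volume of
   [steiner u (cdual K)]. *)
apply: lee_pmul; rewrite ?Vol_ge0//.
  apply: Vol_le_steiner u1 _ convK KM.
  exact: compact_closed (@norm_hausdorff _ _) compK.
apply: le_trans (Vol_le_steiner u1 (@closed_cdual _ _ K) (@convex_cdual _ _ K) KM') _.
by apply: le_Vol => x /sub1 /sub2.
Qed.
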